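(* Let $n,d\ge 1$, let $\Omega\subset\mathbb{R}^d$ be compact, identified (after an affine rescaling) with $[0,1]^d$, and let $\nu$ be a probability measure on $\Omega$. Let $f:[0,1]^n\times\Omega\to\mathbb{R}$ be a real $1$-periodic trigonometric polynomial in $(x,\omega)$ of degree $2r$, and let $c^*(\omega)=\inf_{x\in[0,1]^n} f(x,\omega)$. Set $p^*=\int_\Omega c^*(\omega)\,\mathrm{d}\nu(\omega)$. For an integer $s\ge 1$, let $m_s(x,\omega)$ be a (column) vector whose entries span the real trigonometric polynomials in $(x,\omega)$ of degree $\le s$, and define $$p^*_{2s}=\sup\Big\{\int_\Omega c(\omega)\,\mathrm{d}\nu(\omega)\;:\; c \text{ a real trigonometric polynomial in }\omega\text{ of degree}\le 2s,\ W\succcurlyeq 0,\ f(x,\omega)-c(\omega)=m_s(x,\omega)^T W m_s(x,\omega)\ \forall (x,\omega)\Big\}.$$ Then there are constants $C>0$ and $s_0$, depending only on $\|f-\bar f\|_F$, $\|c^*-\bar c^*\|_F$, the Lipschitz constant of $c^*$, $r$, $\Omega$, $n$ and $d$, such that for all $s\ge s_0$, $$0\le p^*-p^*_{2s}=\int_\Omega\big[c^*(\omega)-c^*_{2s}(\omega)\big]\mathrm{d}\nu(\omega)\le C\,\frac{\ln s}{s},$$ where $c^*_{2s}$ denotes an optimal (or near-optimal) $c$ in the definition of $p^*_{2s}$. In particular $p^*_{2s}\to p^*$ as $s\to\infty$.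
   Context: A (real, 1-periodic) trigonometric polynomial of degree $\le k$ in variables $z\in\mathbb{R}^m$ is a finite real-valued sum $\sum_{\hat z\in\mathbb{Z}^m,\|\hat z\|_\infty\le k}\hat g(\hat z)e^{2i\pi \hat z^T z}$. For such a function $g$ on $[0,1]^n$ (possibly depending on other parameters), $\bar g=\int_{[0,1]^n} g(x)\,\mathrm{d}x$ is its average and $\|g\|_F=\sum_{\hat z}|\hat g(\hat z)|$ is the sum of absolute values of its Fourier coefficients. $W\succcurlyeq 0$ means $W$ is symmetric positive semidefinite. The function $c^*$ is Lipschitz continuous. *)

(* Defs.v *)
From HB Require Import structures.
From mathcomp Require Import all_boot all_order all_algebra.
From mathcomp Require Import all_classical all_reals all_analysis.
Set Implicit Arguments. Unset Strict Implicit. Unset Printing Implicit Defensive.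
Import Order.TTheory GRing.Theory Num.Theory.
Import numFieldNormedType.Exports.
Local Open Scope classical_set_scope.
Local Open Scope ring_scope.

Section Defs.
Variable R : realType.

Definition cube (m : nat) : set (m.-tuple R) :=
  [set z | forall i : 'I_m, 0 <= tnth z i <= 1].
Arguments cube m : clear implicits.

(* bounded frequencies zhat in Z^m with ||zhat||_oo <= k, encoded as
   j : 'I_m -> 'I_(2k+1), zhat_i = j_i - k *)
Definition freq (m k : nat) := {ffun 'I_m -> 'I_(k.*2).+1}.

Definition phase (m k : nat) (j : freq m k) (z : m.-tuple R) : R :=
  \sum_(i < m) (((j i : nat)%:R - k%:R) * tnth z i).

(* real 1-periodic trigonometric polynomial of degree <= k in m variables:
   g z = sum_zhat ghat(zhat) e^{2 i pi zhat.z}, with ghat(zhat) = a + i b,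
   and the sum is real (imaginary part vanishes) *)
Definition trigpoly (m k : nat) (g : m.-tuple R -> R) : Prop :=
  exists a b : freq m k -> R, forall z : m.-tuple R,
    g z = \sum_(j : freq m k)
            (a j * cos (2 * pi * phase j z) - b j * sin (2 * pi * phase j z))
    /\ \sum_(j : freq m k)
            (a j * sin (2 * pi * phase j z) + b j * cos (2 * pi * phase j z)) = 0.

Fixpoint iint_seq (k : nat) (h : seq R -> R) : R :=
  if k is k'.+1 then
    Rintegral (@lebesgue_measure R) `[0%R, 1%R]%classic
      (fun t => iint_seq k' (fun l => h (t :: l)))
  else h [::].

Definition cube_integral (m : nat) (g : m.-tuple R -> R) : R :=
  iint_seq m (fun l => g (insubd (nseq_tuple m 0) l)).

Definition average (m : nat) (g : m.-tuple R -> R) : R := cube_integral g.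

Definition centered (m : nat) (g : m.-tuple R -> R) : m.-tuple R -> R :=
  fun z => g z - average g.

(* Fourier coefficient ghat(zhat) = int g(z) e^{-2 i pi zhat.z} dz, zhat in Z^m *)
Definition zphase (m : nat) (zh : {ffun 'I_m -> int}) (z : m.-tuple R) : R :=
  \sum_(i < m) ((zh i)%:~R * tnth z i).

Definition fourier_re (m : nat) (g : m.-tuple R -> R) (zh : {ffun 'I_m -> int}) : R :=
  cube_integral (fun z => g z * cos (2 * pi * zphase zh z)).
Definition fourier_im (m : nat) (g : m.-tuple R -> R) (zh : {ffun 'I_m -> int}) : R :=
  - cube_integral (fun z => g z * sin (2 * pi * zphase zh z)).

Definition Fnorm (m : nat) (g : m.-tuple R -> R) : \bar R :=
  (\esum_(zh in [set: {ffun 'I_m -> int}])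
     (Num.sqrt (fourier_re g zh ^+ 2 + fourier_im g zh ^+ 2))%:E)%E.

Definition pt (n d : nat) (x : n.-tuple R) (w : d.-tuple R) : (n + d).-tuple R :=
  [tuple of x ++ w].

Definition cstar (n d : nat) (f : (n + d).-tuple R -> R) : d.-tuple R -> R :=
  fun w => inf [set f (pt x w) | x in cube n].

Definition eucl_dist (m : nat) (z z' : m.-tuple R) : R :=
  Num.sqrt (\sum_(i < m) (tnth z i - tnth z' i) ^+ 2).

Definition lipschitz_with (m : nat) (g : m.-tuple R -> R) (L : R) : Prop :=
  forall z z' : m.-tuple R, `|g z - g z'| <= L * eucl_dist z z'.

(* m_s(z): vector of cos(2 pi zhat.z), sin(2 pi zhat.z), ||zhat||_oo <= s,
   whose entries span the real trig. polynomials of degree <= s *)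
Definition msize (m s : nat) := #|{: freq m s * bool}|.

Definition mvec (m s : nat) (z : m.-tuple R) : 'rV[R]_(msize m s) :=
  \row_(j < msize m s)
    let: (k, b) := enum_val j in
    if b then cos (2 * pi * phase k z) else sin (2 * pi * phase k z).

Definition psd (N : nat) (W : 'M[R]_N) : Prop :=
  W^T = W /\ forall v : 'rV[R]_N, 0 <= (v *m W *m v^T) 0 0.

Definition psos (n d : nat) (f : (n + d).-tuple R -> R)
    (nu : probability (d.-tuple R) R) (s : nat) : \bar R :=
  ereal_sup [set (Rintegral nu (cube d) c)%:E | c in
    [set c : d.-tuple R -> R | trigpoly (s.*2) c /\
       exists W : 'M[R]_(msize (n + d) s), psd W /\
         forall x w, cube n x -> cube d w ->
           f (pt x w) - c w
             = (mvec s (pt x w) *m W *m (mvec s (pt x w))^T) 0 0]].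

Definition pstar (n d : nat) (f : (n + d).-tuple R -> R)
    (nu : probability (d.-tuple R) R) : R :=
  Rintegral nu (cube d) (cstar f).

End Defs.
Arguments cube {R} m.

(* Main.v *)
(** Let [K] be the product over all [n + d] variables of the squared modulus of
    [q(t) = \sum_j sin ((j + 1) h) e^{2 i pi (j - s) t}], [0 <= j <= 2 s],
    [h = pi / (2 s + 2)], normalised to have mean 1, and let [T] be convolution
    with [K].  [T] is taken over a regular grid with [N = 2 (s + r) + 2] points
    per variable, fine enough for the sums to be exact on the frequencies of [f],
    so that no integration is needed.

    [T] maps a function that is nonnegative on the grid to a sum of squares of
    degree [s], multiplies the frequency [k] by
    [\prod_i lambda_(k_i)], and the sine weights give
    [lambda_1 = cos h], whence [1 - lambda_k <= k^2 h^2 / 2].  On the degree [2 r]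
    polynomial [f], [T] is therefore invertible with [T^-1 f >= f - eps],
    [eps = O(s^-2)], where the constant is controlled by the Fourier coefficients
    of [f - average f].  Then [T^-1 f - c* + eps >= 0], so
    [f - (T c* - eps) = T (T^-1 f - c* + eps)] is a sum of squares and
    [T c* - eps] is feasible.  Finally [|T c* - c*| = O(L / s)]: the kernel has
    second moment [O(s^-2)], hence first moment [O(1 / s)] by AM-GM, and [c*] is
    Lipschitz and periodic.  This gives the rate [1 / s], better than
    [ln s / s].  The same estimate makes [c*] a limit of trigonometric
    polynomials, hence measurable. *)

Require Import Defs.
From HB Require Import structures.
From mathcomp Require Import all_boot all_order all_algebra.
From mathcomp Require Import all_classical all_reals all_analysis.
From mathcomp Require Import measurable_realfun complex ring lra zify.
Set Implicit Arguments. Unset Strict Implicit. Unset Printing Implicit Defensive.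
Import Order.TTheory GRing.Theory Num.Theory.
Import numFieldNormedType.Exports.
Local Open Scope classical_set_scope.
Local Open Scope ring_scope.
Local Open Scope complex_scope.

(** * Elementary inequalities for sine and cosine *)

Section TrigInequalities.
Variable R : realType.
Implicit Types (t u : R) (k : nat).

Lemma sin_mean_value u : 0 < u -> exists2 v, 0 < v < u & sin u = u * cos v.
Proof.
move=> u0.
have [|v] := @MVT R sin cos 0 u u0 (fun x _ => is_derive_sin x).
  by apply: continuous_subspaceT => x; exact: continuous_sin.
by rewrite in_itv /= sin0 !subr0 mulrC => v0u ->; exists v.
Qed.

Lemma normr_sin_le u : `|sin u| <= `|u|.
Proof.
have pos (v : R) : 0 < v -> `|sin v| <= `|v|.
  move=> v0; have [w _ ->] := sin_mean_value v0.
  by rewrite normrM ler_piMr ?cos_max.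
have [u0|u0|<-] := ltgtP 0 u; [exact: pos| |by rewrite sin0 normr0].
by rewrite -normrN -[leRHS]normrN -sinN; apply: pos; rewrite oppr_gt0.
Qed.

Lemma oneBcos2 u : 1 - cos (u *+ 2) = 2 * sin u ^+ 2.
Proof. rewrite cos_mulr2n cos2sin2; ring. Qed.

Lemma oneBcos_le u : 1 - cos u <= u ^+ 2 / 2.
Proof.
have -> : u = (u / 2) *+ 2 by field.
rewrite oneBcos2 -(real_normK (num_real (sin _))).
have := normr_sin_le (u / 2); rewrite -ler_sqr ?nnegrE// (real_normK (num_real (u/2))).
nra.
Qed.

Lemma normr_sin_natM k u : `|sin (k%:R * u)| <= k%:R * `|sin u|.
Proof.
elim: k => [|k IH]; first by rewrite !mul0r sin0 normr0.
rewrite -natr1 mulrDl mul1r sinD (le_trans (ler_normD _ _))// mulrDl mul1r.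
by rewrite lerD// normrM ?[`|cos _| * _]mulrC ?(le_trans _ IH)// ler_piMr ?cos_max.
Qed.

(** Through [1 - cos (2 v) = 2 sin^2 v] this is the square of [normr_sin_natM]. Averaged against a
    nonnegative kernel, it controls the multiplier of every frequency by that of frequency 1. *)
Lemma oneBcos_natM k u : 1 - cos (k%:R * u) <= k%:R ^+ 2 * (1 - cos u).
Proof.
have -> : u = (u / 2) *+ 2 by field.
rewrite mulrnAr !oneBcos2 -(real_normK (num_real (sin (k%:R * _)))).
rewrite -(real_normK (num_real (sin (u/2)))).
have := normr_sin_natM k (u / 2); rewrite -ler_sqr ?nnegrE ?mulr_ge0// exprMn.
nra.
Qed.

Lemma oneBcos_intM (k : int) u : 1 - cos (k%:~R * u) <= (k%:~R) ^+ 2 * (1 - cos u).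
Proof.
case: k => k; first exact: oneBcos_natM.
by rewrite NegzE mulrNz mulNr cosN sqrrN; exact: oneBcos_natM.
Qed.

(* With h = pi |t| / 2 <= pi / 4: sin (2 h) = 2 sin h cos h >= 2 h cos^2 h >= h >= |t|. *)
Lemma normr_le_sinpi t : `|t| <= 1 / 2 -> `|t| <= `|sin (pi * t)|.
Proof.
have pos (x : R) : 0 < x -> x <= 1/2 -> x <= sin (pi * x).
  move=> x0 x12; have p2 := @pi_ge2 R.
  pose h := pi * x / 2.
  have -> : pi * x = h *+ 2 by rewrite /h; field.
  have h0 : 0 < h by rewrite /h divr_gt0 ?mulr_gt0 ?pi_gt0.
  have hle : h <= pi / 4 by rewrite /h; nra.
  have [v /andP[v0 vh] hv] := sin_mean_value h0.
  have hI : h \in `[0, pi] by rewrite in_itv /=; apply/andP; split; lra.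
  have cvh : cos h <= cos v.
    rewrite leNgt ltr_cos -?leNgt ?(ltW vh)// in_itv /=; apply/andP; split; lra.
  have ch : cos (pi / 4) <= cos h.
    by rewrite leNgt ltr_cos -?leNgt// in_itv /=; apply/andP; split; lra.
  have c4 : cos (pi / 4 : R) ^+ 2 = 1 / 2.
    have : cos (pi / 2 : R) = cos ((pi / 4) *+ 2) by congr cos; field.
    rewrite cos_pihalf cos_mulr2n; lra.
  have c40 : 0 <= cos (pi / 4 : R) by apply: cos_ge0_pihalf; apply/andP; split; lra.
  have ch2 : 1 / 2 <= cos h ^+ 2 by rewrite -c4; nra.
  have csh : h * cos h ^+ 2 <= cos h * sin h 
    by have hc : 0 <= h * cos h; [rewrite mulr_ge0 ?(ltW h0)//; lra | rewrite hv; nra].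
  have xh : x <= h by rewrite /h; nra.
  rewrite sin_mulr2n; nra.
move=> t12; have [->|t0] := eqVneq t 0; first by rewrite mulr0 sin0.
have nt : 0 < `|t| by rewrite normr_gt0.
apply: (le_trans (pos _ nt t12)).
have [tp|tn] := leP 0 t; first by rewrite ger0_norm// ler_norm.
by rewrite ltr0_norm// mulrN sinN (le_trans (ler_norm _))// normrN.
Qed.

End TrigInequalities.

(** * The 1-periodic complex exponential and discrete orthogonality *)

Section ComplexExponential.
Variable R : realType.
Implicit Types (t u : R).

Lemma Re_sum (I : Type) (r : seq I) (P : pred I) (F : I -> R[i]) :
  complex.Re (\sum_(i <- r | P i) F i) = \sum_(i <- r | P i) complex.Re (F i).
Proof. by apply: (big_morph (@complex.Re R)) => // -[a b] [c d]. Qed.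

Lemma Im_sum (I : Type) (r : seq I) (P : pred I) (F : I -> R[i]) :
  complex.Im (\sum_(i <- r | P i) F i) = \sum_(i <- r | P i) complex.Im (F i).
Proof. by apply: (big_morph (@complex.Im R)) => // -[a b] [c d]. Qed.

Lemma Re_realM (a : R) (z : R[i]) : complex.Re (a%:C * z) = a * complex.Re z.
Proof. by case: z => b c /=; rewrite mul0r subr0. Qed.

Lemma realcM (a b : R) : (a * b)%:C = a%:C * b%:C.
Proof. exact: rmorphM. Qed.

Lemma realc_nat (n : nat) : (n%:R : R)%:C = n%:R.
Proof. exact: rmorph_nat. Qed.

Lemma realcV (a : R) : (a^-1)%:C = (a%:C)^-1.
Proof. exact: fmorphV. Qed.

Lemma realc_sum (I : Type) (r : seq I) (P : pred I) (F : I -> R) :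
  (\sum_(i <- r | P i) F i)%:C = \sum_(i <- r | P i) (F i)%:C.
Proof. exact: rmorph_sum. Qed.

Lemma conjcM (y z : R[i]) : conjc (y * z) = conjc y * conjc z.
Proof. exact: rmorphM. Qed.

Lemma conjc_sum (I : Type) (r : seq I) (P : pred I) (F : I -> R[i]) :
  conjc (\sum_(i <- r | P i) F i) = \sum_(i <- r | P i) conjc (F i).
Proof. exact: rmorph_sum. Qed.

Definition cexp t : R[i] := cos (2 * pi * t) +i* sin (2 * pi * t).

Lemma cexpD t u : cexp (t + u) = cexp t * cexp u.
Proof.
rewrite /cexp mulrDr cosD sinD; congr (_ +i* _);
  by rewrite [RHS]addrC mulrC [X in _ + X]mulrC addrC.
Qed.

Lemma cexp0 : cexp 0 = 1.
Proof. by rewrite /cexp mulr0 cos0 sin0. Qed.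

Lemma cexp_sum (I : Type) (r : seq I) (P : pred I) (F : I -> R) :
  cexp (\sum_(i <- r | P i) F i) = \prod_(i <- r | P i) cexp (F i).
Proof. by apply: (big_morph cexp cexpD cexp0). Qed.

Lemma conjc_cexp t : conjc (cexp t) = cexp (- t).
Proof. by rewrite /cexp mulrN cosN sinN. Qed.

Lemma cexpM_nat n t : cexp (n%:R * t) = cexp t ^+ n.
Proof.
elim: n => [|n IH]; first by rewrite mul0r cexp0.
by rewrite -natr1 mulrDl mul1r cexpD IH exprSr.
Qed.

Lemma cexp_nat (n : nat) : cexp n%:R = 1.
Proof.
rewrite -[n%:R]mulr1 cexpM_nat.
have -> : cexp 1 = 1; last by rewrite expr1n.
by rewrite /cexp mulr1 mulrC mulr_natr cos2pi sin2pi.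
Qed.

Lemma cexp_int (k : int) : cexp k%:~R = 1.
Proof.
case: k => k; first exact: cexp_nat.
rewrite NegzE mulrNz -conjc_cexp.
have -> := cexp_nat k.+1.
by rewrite conjc1.
Qed.

(** At the value 1, [1 - cos (2 pi t) = 2 sin^2 (pi t)] would vanish, but [pi t] lies strictly
    between 0 and [pi]. *)
Lemma cexp_neq1 t : 0 < t < 1 -> cexp t != 1.
Proof.
move=> /andP[t0 t1]; apply/negP => /eqP[] + _.
have -> : 2 * pi * t = (pi * t) *+ 2 by ring.
have : 0 < sin (pi * t).
  by apply: sin_gt0_pi; rewrite mulr_gt0 ?pi_gt0//= gtr_pMr ?pi_gt0.
have := oneBcos2 (pi * t) => + s0 c1; rewrite c1; nra.
Qed.

(** For nonzero [k] this is a geometric sum whose ratio is an [N]-th root of unity, different from 1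
    because [0 < |k| < N]. Negative [k] follow by conjugation. *)
Lemma sum_cexp_grid (N : nat) (k : int) : (`|k| < N)%N ->
  \sum_(y < N) cexp (k%:~R * (y%:R / N%:R)) = if k == 0 then N%:R else 0.
Proof.
move=> kN; have N0 : (N%:R : R) != 0 by rewrite pnatr_eq0; lia.
case: eqP => [->|k0].
  under eq_bigr do rewrite mul0r cexp0.
  by rewrite sumr_const card_ord.
have kpos (l : nat) : (0 < l < N)%N -> \sum_(y < N) cexp (l%:R * (y%:R / N%:R)) = 0.
  move=> /andP[l0 lN].
  have e1 : cexp (l%:R / N%:R) != 1.
    apply: cexp_neq1; rewrite divr_gt0 ?ltr0n//=; last lia.
    by rewrite ltr_pdivrMr ?mul1r ?ltr_nat// ltr0n; lia.
  have : (1 - cexp (l%:R / N%:R)) * \sum_(y < N) cexp (l%:R * (y%:R / N%:R)) = 0.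
    under eq_bigr => y _.
      have -> : l%:R * (y%:R / N%:R) = y%:R * (l%:R / N%:R) :> R by field.
      rewrite cexpM_nat; over.
    rewrite -opprB mulNr -subrX1 -cexpM_nat.
    have -> : N%:R * (l%:R / N%:R) = l%:R :> R by field.
    by rewrite cexp_nat subrr oppr0.
  by move/eqP; rewrite mulf_eq0 subr_eq0 eq_sym (negbTE e1) => /eqP.
case: k kN k0 => k kN k0; first by apply: kpos; lia.
rewrite NegzE; transitivity (conjc (\sum_(y < N) cexp (k.+1%:R * (y%:R / N%:R)))).
  rewrite conjc_sum; apply: eq_bigr => y _.
  by rewrite conjc_cexp mulrNz mulNr.
by rewrite kpos ?conjc0//; lia.
Qed.

End ComplexExponential.

(** * The Fejer-Korovkin kernel in one variable: multipliers and moments *)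

Section Kernel.
Variables (R : realType) (s : nat).
Implicit Types (t : R) (k : int).

(** The shift [j.+1] and the denominator [2 s + 2] make the weights vanish at the indices -1 and
    [2 s + 1], just outside the range of [freqpoly]. *)
Definition sinwt (j : nat) : R := sin (j.+1%:R * (pi / (s.*2).+2%:R)).

Definition sinwt_norm : R := \sum_(j < (s.*2).+1) sinwt j ^+ 2.

Definition freqpoly t : R[i] :=
  \sum_(j < (s.*2).+1) (sinwt j)%:C * cexp ((j%:R - s%:R) * t).

Definition kern t : R :=
  (complex.Re (freqpoly t) ^+ 2 + complex.Im (freqpoly t) ^+ 2) / sinwt_norm.

(** The normalised autocorrelation of the weights, that is, the Fourier coefficient of [kern] at
    [k]; it is 0 for [|k| > 2 s]. *)
Definition kernhat k : R :=
  (\sum_(j < (s.*2).+1) \sum_(l < (s.*2).+1)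
     if (j : int) - (l : int) == k then sinwt j * sinwt l else 0) / sinwt_norm.

Lemma sinwt_norm_gt0 : 0 < sinwt_norm.
Proof.
rewrite /sinwt_norm big_ord_recl ltr_wpDr//.
  by apply: sumr_ge0 => j _; exact: sqr_ge0.
have p0 := @pi_gt0 R.
rewrite exprn_gt0// sin_gt0_pi// mul1r divr_gt0//=.
by rewrite ltr_pdivrMr ?ltr0n// ltr_pMr// ltr1n.
Qed.

Lemma kern_ge0 t : 0 <= kern t.
Proof. by rewrite divr_ge0 ?(ltW sinwt_norm_gt0)// addr_ge0// sqr_ge0. Qed.

Lemma kern_div_ge0 t (N : nat) : 0 <= kern t / N%:R.
Proof. by rewrite mulr_ge0 ?kern_ge0// invr_ge0. Qed.

Lemma kernE t : (kern t)%:C = (sinwt_norm^-1)%:C *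
  \sum_(j < (s.*2).+1) \sum_(l < (s.*2).+1)
     (sinwt j * sinwt l)%:C * cexp ((j%:R - l%:R) * t).
Proof.
rewrite /kern realcM add_Re2_Im2 sqr_normc mulrC; congr (_ * _).
rewrite /freqpoly conjc_sum mulr_suml.
apply: eq_bigr => j _; rewrite mulr_sumr; apply: eq_bigr => l _.
rewrite conjcM conjc_real conjc_cexp realcM mulrACA -cexpD.
by congr (_ * cexp _); ring.
Qed.

(** Expanding by [kernE] leaves grid sums of frequency [k - (j - l)], of modulus at most
    [2 s + |k| < N]; by orthogonality only the pairs with [j - l = k] survive. *)
Lemma kern_eigen (N : nat) k t : (s.*2 + `|k| < N)%N ->
  \sum_(y < N) (kern (t - y%:R / N%:R) / N%:R)%:C * cexp (k%:~R * (y%:R / N%:R))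
    = (kernhat k)%:C * cexp (k%:~R * t).
Proof.
move=> kN; have N0 : (N%:R : R) != 0 by rewrite pnatr_eq0; lia.
have N0c : (N%:R : R[i]) != 0 by rewrite pnatr_eq0; lia.
under eq_bigr => y _.
  rewrite realcM kernE -[X in X * _]mulrA mulr_suml -mulrA mulr_suml.
  over.
rewrite -mulr_sumr exchange_big /= [kernhat k]mulrC realcM -mulrA; congr (_ * _).
rewrite realc_sum mulr_suml; apply: eq_bigr => j _.
under eq_bigr do rewrite !mulr_suml.
rewrite exchange_big realc_sum mulr_suml; apply: eq_bigr => l _.
transitivity ((sinwt j * sinwt l / N%:R)%:C * cexp ((j%:R - l%:R) * t) *
  \sum_(y < N) cexp ((k - (j%:Z - l%:Z))%:~R * (y%:R / N%:R))).
  rewrite mulr_sumr; apply: eq_bigr => y _.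
  have -> : (k - (j%:Z - l%:Z))%:~R * (y%:R / N%:R) =
     - ((j%:R - l%:R) * (y%:R / N%:R)) + k%:~R * (y%:R / N%:R) :> R.
    by rewrite !rmorphB /= !pmulrn; ring.
  rewrite mulrBr !cexpD !realcM; ring.
rewrite sum_cexp_grid; last by have := ltn_ord j; have := ltn_ord l; lia.
rewrite subr_eq0 eq_sym; case: eqP => [<-|_]; last by rewrite mulr0 mul0r.
by rewrite realcM realcV realc_nat rmorphB /= !pmulrn; field.
Qed.

Lemma kernhat0 : kernhat 0 = 1.
Proof.
rewrite /kernhat.
under eq_bigr => j _.
  rewrite (bigD1 j)//= subrr eqxx big1 ?addr0 => [|l lj]; last first.
    rewrite subr_eq0; case: eqP => // -[jl]; move: lj; rewrite -val_eqE /= jl eqxx//.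
  rewrite -expr2; over.
by rewrite divff// gt_eqF// sinwt_norm_gt0.
Qed.

(* sin ((j-1) h) + sin ((j+1) h) = 2 cos h sin (j h), and the weights vanish
   just outside the index range. *)
Lemma kernhat1 : kernhat 1 = cos (pi / (s.*2).+2%:R).
Proof.
set h := pi / _.
have S0 := sinwt_norm_gt0.
have sumE : \sum_(j < (s.*2).+1) \sum_(l < (s.*2).+1)
    (if (j : int) - (l : int) == 1 then sinwt j * sinwt l else 0) =
    \sum_(l < s.*2) sinwt l.+1 * sinwt l.
  rewrite big_ord_recl big1 ?add0r => [|l _]; last by rewrite ifF//=; lia.
  apply: eq_bigr => j _; rewrite (bigD1 (widen_ord (leqnSn _) j))//= /bump /= add1n.
  rewrite ifT; last by lia.
  rewrite big1 ?addr0// => l; rewrite -val_eqE /= => lj; rewrite ifF//; lia.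
rewrite /kernhat sumE; apply: (mulIf (lt0r_neq0 S0)); rewrite divfK ?lt0r_neq0//.
have last0 : sin ((s.*2).+2%:R * h) = 0.
  by rewrite /h mulrC divfK ?pnatr_eq0// sinpi.
have step (j : nat) : sinwt j * sin (j%:R * h) + sinwt j * sinwt j.+1
    = 2 * (cos h * sinwt j ^+ 2).
  rewrite /sinwt -/h -[in sin (j%:R * h)](_ : j.+1%:R * h - h = j%:R * h); last first.
    by rewrite -natr1; ring.
  rewrite (_ : j.+2%:R * h = j.+1%:R * h + h); last by rewrite -[j.+2%:R]natr1; ring.
  rewrite sinB sinD; ring.
set X := \sum_(l < s.*2) _.
suff : X + X = 2 * (cos h * sinwt_norm) by lra.
rewrite /sinwt_norm !mulr_sumr -(eq_bigr _ (fun (j : 'I_(s.*2).+1) _ => step j)) big_split /=.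
congr (_ + _).
  rewrite big_ord_recl mul0r sin0 mulr0 add0r; apply: eq_bigr => j _.
  by rewrite /= /bump /= add1n.
rewrite big_ord_recr /= [sinwt (s.*2).+1]/sinwt -/h last0 mulr0 addr0.
by apply: eq_bigr => j _; rewrite mulrC.
Qed.

Lemma sum_kern (N : nat) t : (s.*2 < N)%N ->
  \sum_(y < N) kern (t - y%:R / N%:R) / N%:R = 1.
Proof.
move=> sN; apply: (@complexI R); rewrite realc_sum /=.
have := @kern_eigen N 0 t; rewrite addn0 => /(_ sN); rewrite kernhat0 mul0r cexp0 mulr1.
move=> <-; apply: eq_bigr => y _; by rewrite mul0r cexp0 mulr1.
Qed.

(** Conjugating the eigenvalue identity and multiplying by [cexp (k t)] removes the phase on the
    right; the real part shows the multiplier as a kernel average of cosines. *)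
Lemma sum_kern_cos (N : nat) k t : (s.*2 + `|k| < N)%N ->
  \sum_(y < N) kern (t - y%:R / N%:R) / N%:R * cos (2 * pi * (k%:~R * (t - y%:R / N%:R)))
  = kernhat k.
Proof.
move=> sN; have := kern_eigen t sN => /(congr1 (fun z => complex.Re (conjc z * cexp (k%:~R * t)))).
have -> : conjc ((kernhat k)%:C * cexp (k%:~R * t)) * cexp (k%:~R * t) = (kernhat k)%:C.
  rewrite conjcM conjc_real conjc_cexp -mulrA -cexpD addNr cexp0 mulr1//.
move=> /= <-; rewrite conjc_sum mulr_suml Re_sum.
apply: eq_bigr => y _.
rewrite conjcM conjc_real conjc_cexp -[X in _ = complex.Re X]mulrA -cexpD Re_realM.
congr (_ * cos (_ * _)); ring.
Qed.

Lemma sum_kern_cos1 (N : nat) t : ((s.*2).+1 < N)%N ->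
  \sum_(y < N) kern (t - y%:R / N%:R) / N%:R * cos (2 * pi * (t - y%:R / N%:R))
  = kernhat 1.
Proof.
move=> sN; have := @sum_kern_cos N 1 t; rewrite addn1 => /(_ sN) <-.
by apply: eq_bigr => y _; rewrite mul1r.
Qed.

(** The left side is a kernel average of [1 - cos]. As the kernel is nonnegative, [oneBcos_intM]
    applies termwise and reduces to [k = 1], where the multiplier is an explicit cosine. *)
Lemma oneBkernhat_le k : 1 - kernhat k <= k%:~R ^+ 2 * (pi ^+ 2 / s.*2.+2%:R ^+ 2 / 2).
Proof.
(* An auxiliary grid that resolves the frequencies 0, 1 and [k] at once, so that the three sums can
   be compared term by term. *)
pose N := (s.*2 + `|k| + 2)%N.
rewrite -(@sum_kern_cos N k 0); last by lia.
rewrite -[X in X - _ <= _](@sum_kern N 0); last by lia.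
rewrite -sumrB.
apply: (@le_trans _ _ (k%:~R ^+ 2 * (1 - kernhat 1))); last first.
  by rewrite ler_wpM2l ?sqr_ge0// kernhat1 (le_trans (oneBcos_le _))// expr_div_n.
rewrite -(@sum_kern_cos1 N 0); last by lia.
rewrite -[X in _ * (X - _)](@sum_kern N 0); last by lia.
rewrite -sumrB mulr_sumr; apply: ler_sum => y _.
set a := kern _ / _; have a0 : 0 <= a by exact: kern_div_ge0.
have := ler_wpM2l a0 (oneBcos_intM k (2 * pi * (0 - y%:R / N%:R))).
by rewrite mulrCA; lra.
Qed.

(** The first moment of the kernel for the periodic distance [|sin (pi u)|]. With [v] this distance,
    [v <= (s + 1) v^2 + 1 / (s + 1)], and the mean of [v^2] is [(1 - kernhat 1) / 2], of order
    [s^-2]. *)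
Lemma sum_kern_sin (N : nat) t : ((s.*2).+1 < N)%N ->
  \sum_(y < N) kern (t - y%:R / N%:R) / N%:R * `|sin (pi * (t - y%:R / N%:R))|
  <= (pi ^+ 2 + 1) / s.+1%:R.
Proof.
move=> sN.
apply: (@le_trans _ _ (\sum_(y < N) kern (t - y%:R / N%:R) / N%:R *
   ((1 - cos (2 * pi * (t - y%:R / N%:R))) * s.+1%:R / 2 + s.+1%:R^-1))).
  apply: ler_sum => y _; rewrite ler_wpM2l ?kern_div_ge0//.
  set u := t - _; rewrite (_ : 2 * pi * u = (pi * u) *+ 2); last ring.
  rewrite oneBcos2 -(real_normK (num_real (sin _))); set v := `|_|.
  have s0 : (0 : R) < s.+1%:R by rewrite ltr0n.
  rewrite -(@ler_pM2r _ s.+1%:R)// mulrDl mulVf ?gt_eqF//.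
  have := sqr_ge0 (v * s.+1%:R - 1); nra.
have -> : \sum_(y < N) kern (t - y%:R / N%:R) / N%:R *
    ((1 - cos (2 * pi * (t - y%:R / N%:R))) * s.+1%:R / 2 + s.+1%:R^-1) =
    (1 - kernhat 1) * (s.+1%:R / 2) + s.+1%:R^-1.
  rewrite -(sum_kern_cos1 t sN) -[X in X - _](@sum_kern N t); last by lia.
  rewrite -[s.+1%:R^-1 in RHS]mul1r -[X in _ + X * _](@sum_kern N t); last by lia.
  rewrite -sumrB !mulr_suml -big_split /=; apply: eq_bigr => y _; ring.
rewrite [X in _ <= X]mulrDl mul1r lerD2r.
have := oneBkernhat_le 1; rewrite expr1n mul1r => le1.
have s0 : (0 : R) < s.+1%:R by rewrite ltr0n.
have p0 := @pi_gt0 R.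
apply: (@le_trans _ _ (pi ^+ 2 / s.*2.+2%:R ^+ 2 / 2 * s.+1%:R / 2)).
  by rewrite -[X in _ <= X]mulrA ler_wpM2r// mulr_ge0// ltW.
rewrite (_ : s.*2.+2%:R = 2 * s.+1%:R); last by rewrite -natrM mul2n.
(* The value is exactly [pi^2 / (16 (s + 1))]; the factor 16 is then given away. *)
rewrite (_ : _ / 2 = (pi ^+ 2 / s.+1%:R) / 16); last by field; rewrite addrC natr1 gt_eqF.
rewrite ler_pdivrMr// ler_peMr ?ler1n// divr_ge0// ?sqr_ge0// ltW//.
Qed.

End Kernel.

(** * The product kernel on a grid and approximation of periodic Lipschitz functions *)

Section ProductKernel.
Variables (R : realType) (s N : nat).
Implicit Types (m : nat).

Definition gridpt m (y : {ffun 'I_m -> 'I_N}) : m.-tuple R :=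
  [tuple (y i)%:R / N%:R | i < m].

(** The quadrature factor [1 / N] is included, so that the weights form a probability vector over
    the grid once [2 s < N]. *)
Definition kernw m (z : m.-tuple R) (y : {ffun 'I_m -> 'I_N}) : R :=
  \prod_(i < m) (kern s (tnth z i - (y i)%:R / N%:R) / N%:R).

Lemma gridpt_cube m (y : {ffun 'I_m -> 'I_N}) : cube m (gridpt y).
Proof.
move=> i; rewrite tnth_mktuple; have yN := ltn_ord (y i).
have N0 : (0 : R) < N%:R by rewrite ltr0n (leq_ltn_trans _ yN).
by rewrite divr_ge0//= ler_pdivrMr// mul1r ler_nat ltnW.
Qed.

Lemma kernw_ge0 m (z : m.-tuple R) y : 0 <= kernw z y.
Proof. by apply: prodr_ge0 => i _; exact: kern_div_ge0. Qed.

Lemma kernw_eigen m (k : 'I_m -> int) (z : m.-tuple R) :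
  (forall i, s.*2 + `|k i| < N)%N ->
  \sum_y (kernw z y)%:C * cexp (\sum_(i < m) (k i)%:~R * tnth (gridpt y) i)
   = (\prod_(i < m) kernhat R s (k i))%:C * cexp (\sum_(i < m) (k i)%:~R * tnth z i).
Proof.
move=> kN; rewrite cexp_sum rmorph_prod -big_split /=.
under [RHS]eq_bigr => i _ do rewrite -(kern_eigen _ (kN i)).
rewrite bigA_distr_bigA /=; apply: eq_bigr => y _.
rewrite cexp_sum rmorph_prod -big_split /=.
by apply: eq_bigr => i _; rewrite tnth_mktuple.
Qed.

Lemma sum_kernw m (z : m.-tuple R) : (s.*2 < N)%N -> \sum_y kernw z y = 1.
Proof.
move=> sN.
rewrite -(bigA_distr_bigA (fun i (y : 'I_N) => kern s (tnth z i - y%:R / N%:R) / N%:R)) /=.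
by rewrite big1// => i _; rewrite sum_kern.
Qed.

(** Summing over the other coordinates gives 1 for each, which leaves the marginal in coordinate
    [i]. *)
Lemma sum_kernw_coord m (z : m.-tuple R) (i : 'I_m) (g : 'I_N -> R) : (s.*2 < N)%N ->
  \sum_y kernw z y * g (y i) =
  \sum_(a < N) kern s (tnth z i - a%:R / N%:R) / N%:R * g a.
Proof.
move=> sN.
(* [g] becomes a factor of coordinate [i] alone, so that the sum of products factors. *)
transitivity (\sum_(y : {ffun 'I_m -> 'I_N}) \prod_(j < m)
   (kern s (tnth z j - (y j)%:R / N%:R) / N%:R * (if j == i then g (y j) else 1))).
  apply: eq_bigr => y _; rewrite big_split /= -/(kernw z y) -big_mkcond /=.
  by rewrite (big_pred1 i).
rewrite -(bigA_distr_bigA (fun j (a : 'I_N) => kern s (tnth z j - a%:R / N%:R) / N%:R *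
   (if j == i then g a else 1))) /=.
rewrite (bigD1 i)//= eqxx [X in _ * X]big1 ?mulr1// => j ji; rewrite (negbTE ji).
by under eq_bigr do rewrite mulr1; rewrite sum_kern.
Qed.

Lemma kernw_cat n d (x : n.-tuple R) (w : d.-tuple R)
    (yx : {ffun 'I_n -> 'I_N}) (yw : {ffun 'I_d -> 'I_N}) (y : {ffun 'I_(n + d) -> 'I_N}) :
  (forall i, y (lshift d i) = yx i) -> (forall i, y (rshift n i) = yw i) ->
  kernw (pt x w) y = kernw x yx * kernw w yw.
Proof.
move=> yl yr; rewrite /kernw big_split_ord /=.
by congr (_ * _); apply: eq_bigr => i _; rewrite ?(tnth_lshift, tnth_rshift) ?(yl, yr).
Qed.

Definition periodic1 m (c : m.-tuple R -> R) := forall w w' : m.-tuple R,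
  (forall i, exists k : int, tnth w' i = tnth w i + k%:~R) -> c w' = c w.

Lemma eucl_dist_le_sum m (z z' : m.-tuple R) :
  eucl_dist z z' <= \sum_(i < m) `|tnth z i - tnth z' i|.
Proof.
rewrite /eucl_dist -[leRHS]ger0_norm ?sumr_ge0// -sqrtr_sqr ler_wsqrtr//.
(* The induction also carries nonnegativity of the partial sum [b], needed for
   [b^2 + v^2 <= (b + v)^2] with [v >= 0]. *)
apply: (proj2 (_ : 0 <= \sum_(i < m) `|tnth z i - tnth z' i| /\ _)).
elim/big_rec2: _ => [|i a b _ [b0 ab]]; first by rewrite expr0n.
rewrite -(real_normK (num_real (_ - _))); have := normr_ge0 (tnth z i - tnth z' i).
by move=> ?; split; nra.
Qed.

(** [|sin (pi t)|] has period 1, so [t] may be moved by its nearest integer into [[-1/2, 1/2]],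
    where [normr_le_sinpi] applies. *)
Lemma dist_nearest_int (t : R) : exists k : int, `|t - k%:~R| <= `|sin (pi * t)|.
Proof.
exists (Num.floor (t + 1 / 2)); set k := Num.floor _.
have -> : `|sin (pi * t)| = `|sin (pi * (t - k%:~R))|.
  (* [cos (2 pi t)] is unchanged by an integer shift and determines [sin^2 (pi t)]. *)
  have : cexp (t - k%:~R) = cexp t by rewrite cexpD -mulrNz cexp_int mulr1.
  case=> + _.
  have E u : 2 * pi * u = (pi * u) *+ 2 :> R by ring.
  rewrite !E; have := oneBcos2 (pi * t); have := oneBcos2 (pi * (t - k%:~R)).
  move=> h1 h2 h3; rewrite -!sqrtr_sqr; congr Num.sqrt; lra.
apply: normr_le_sinpi; rewrite ler_norml.
have := floor_itv (t + 1 / 2); rewrite -/k intrD => /andP[k1 k2].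
by apply/andP; split; lra.
Qed.

(** Translating each coordinate of [y] by the integer that brings it nearest to [w] does not change
    [c y]. The Lipschitz bound thus holds for the distance on the torus, the one whose kernel moment
    is known. *)
Lemma lipschitz_periodic m (c : m.-tuple R -> R) (L : R) (w y : m.-tuple R) : 0 <= L ->
  periodic1 c -> lipschitz_with c L ->
  `|c y - c w| <= L * \sum_(i < m) `|sin (pi * (tnth w i - tnth y i))|.
Proof.
move=> L0 pc lc.
pose k i := projT1 (cid (dist_nearest_int (tnth w i - tnth y i))).
have kP i : `|tnth w i - tnth y i - (k i)%:~R| <= `|sin (pi * (tnth w i - tnth y i))|.
  by rewrite /k; case: cid.
pose y' : m.-tuple R := [tuple tnth y i + (k i)%:~R | i < m].
have <- : c y' = c y by apply: pc => i; exists (k i); rewrite tnth_mktuple.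
apply: (le_trans (lc _ _)); rewrite ler_wpM2l// (le_trans (eucl_dist_le_sum _ _))//.
apply: ler_sum => i _; rewrite tnth_mktuple (le_trans _ (kP i))//.
by rewrite -normrN opprB opprD addrA.
Qed.

(** A Jackson-type estimate: the weights are nonnegative with sum 1, so the error is at most a
    weighted mean of [|c y - c w|], which splits into one first moment per coordinate. *)
Lemma kernw_approx m (c : m.-tuple R -> R) (L : R) (w : m.-tuple R) : 0 <= L ->
  (s.*2.+1 < N)%N -> periodic1 c -> lipschitz_with c L ->
  `|\sum_y kernw w y * c (gridpt y) - c w| <= L * m%:R * ((pi ^+ 2 + 1) / s.+1%:R).
Proof.
move=> L0 sN pc lc.
rewrite -[c w]mul1r -[X in X * c w](@sum_kernw m w); last by lia.
rewrite mulr_suml -sumrB (le_trans (ler_norm_sum _ _ _))//.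
apply: (@le_trans _ _ (\sum_y kernw w y * (L * \sum_(i < m)
    `|sin (pi * (tnth w i - (y i)%:R / N%:R))|))).
  apply: ler_sum => y _; rewrite -mulrBr normrM (ger0_norm (kernw_ge0 _ _)).
  rewrite ler_wpM2l ?kernw_ge0// (le_trans (lipschitz_periodic _ _ L0 pc lc))//.
  by under eq_bigr do rewrite tnth_mktuple.
under eq_bigr => y _ do rewrite mulrCA mulr_sumr.
rewrite -mulr_sumr exchange_big /= -mulrA ler_wpM2l//.
apply: (@le_trans _ _ (\sum_(i < m) ((pi ^+ 2 + 1) / s.+1%:R))); last first.
  by rewrite sumr_const card_ord -[_ *+ m]mulr_natl.
apply: ler_sum => i _.
rewrite (@sum_kernw_coord _ w i (fun a => `|sin (pi * (tnth w i - a%:R / N%:R))|)); last by lia.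
exact: sum_kern_sin.
Qed.

End ProductKernel.

(** * Trigonometric polynomials with complex coefficients *)

Section TrigonometricPolynomials.
Variables (R : realType).
Implicit Types (m k : nat).

(** One equality in [R[i]] replaces the two real ones of [trigpoly]: its imaginary part says that
    the sum is real. *)
Definition ctrig m k (g : m.-tuple R -> R) := exists c : freq m k -> R[i],
  forall z, (g z)%:C = \sum_j c j * cexp (phase j z).

Lemma trigpolyP m k (g : m.-tuple R -> R) : trigpoly k g <-> ctrig k g.
Proof.
have sumE (c : freq m k -> R[i]) z : \sum_j c j * cexp (phase j z) =
  (\sum_j (complex.Re (c j) * cos (2 * pi * phase j z)
           - complex.Im (c j) * sin (2 * pi * phase j z))) +i*
  (\sum_j (complex.Re (c j) * sin (2 * pi * phase j z)
           + complex.Im (c j) * cos (2 * pi * phase j z))).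
  apply/eqP; rewrite eq_complex Re_sum Im_sum /=.
  by apply/andP; split; apply/eqP/eq_bigr => j _; case: (c j).
split=> [[a [b gE]]|[c gE]].
  exists (fun j => a j +i* b j) => z; rewrite sumE /=.
  by have [-> ->] := gE z.
exists (fun j => complex.Re (c j)), (fun j => complex.Im (c j)) => z /=.
by have := gE z; rewrite sumE => -[<- <-].
Qed.

(** The zero frequency: indices are offset by [k]. *)
Definition freq0 m k : freq m k := [ffun=> inord k].

Lemma freq0E m k i : freq0 m k i = k :> nat.
Proof. by rewrite ffunE inordK// -addnn; lia. Qed.

Lemma phase_freq0 m k z : phase (freq0 m k) z = 0 :> R.
Proof. by apply: big1 => i _; rewrite freq0E subrr mul0r. Qed.

Lemma ctrig_cst m k (a : R) : ctrig k (fun _ : m.-tuple R => a).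
Proof.
exists (fun j => if j == freq0 m k then a%:C else 0) => z.
rewrite (bigD1 (freq0 m k))//= eqxx phase_freq0 cexp0 mulr1 big1 ?addr0// => j.
by move/negbTE ->; rewrite mul0r.
Qed.

Lemma ctrigD m k (g h : m.-tuple R -> R) : ctrig k g -> ctrig k h ->
  ctrig k (fun z => g z + h z).
Proof.
move=> [a gE] [b hE]; exists (fun j => a j + b j) => z.
rewrite rmorphD /= gE hE -big_split /=.
by apply: eq_bigr => j _; rewrite mulrDl.
Qed.

Lemma ctrigZ m k (a : R) (g : m.-tuple R -> R) : ctrig k g ->
  ctrig k (fun z => a * g z).
Proof.
move=> [c gE]; exists (fun j => a%:C * c j) => z.
by rewrite realcM gE mulr_sumr; apply: eq_bigr => j _; rewrite mulrA.
Qed.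

Lemma ctrig_sum m k (I : finType) (g : I -> m.-tuple R -> R) :
  (forall i, ctrig k (g i)) -> ctrig k (fun z => \sum_i g i z).
Proof.
move=> gk; pose c i := projT1 (cid (gk i)).
exists (fun j => \sum_i c i j) => z.
under [RHS]eq_bigr do rewrite mulr_suml.
rewrite exchange_big realc_sum; apply: eq_bigr => i _.
by rewrite /c; case: cid.
Qed.

Lemma kern_fourier s (t : R) : (kern s t)%:C =
  \sum_(k < ((s.*2).*2).+1) (kernhat R s ((k : int) - (s.*2 : int)))%:C *
     cexp ((k%:R - (s.*2)%:R) * t).
Proof.
rewrite kernE.
under [RHS]eq_bigr => k _.
  rewrite /kernhat [X in X%:C]mulrC realcM -mulrA realc_sum mulr_suml.
  under eq_bigr do rewrite realc_sum mulr_suml.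
  over.
rewrite -mulr_sumr; congr (_ * _); rewrite [RHS]exchange_big /=.
apply: eq_bigr => j _; rewrite [RHS]exchange_big /=; apply: eq_bigr => l _.
(* For given [j] and [l], the only index contributing is that of the frequency [j - l], offset by
   [2 s]. *)
have jl : (j + s.*2 - l < ((s.*2).*2).+1)%N by have := ltn_ord j; have := ltn_ord l; lia.
rewrite (bigD1 (Ordinal jl))//= ifT; last by have := ltn_ord l; lia.
rewrite big1 ?addr0 => [|k]; last first.
  rewrite -val_eqE /= => kjl; rewrite ifF ?mul0r//.
  by apply/eqP => jlk; move: kjl; have := ltn_ord l; have := ltn_ord k; lia.
congr (_ * cexp (_ * _)); rewrite natrB; last by have := ltn_ord l; lia.
by rewrite natrD; ring.
Qed.

Lemma ctrig_kernw m s N (y : {ffun 'I_m -> 'I_N}) :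
  ctrig s.*2 (fun z : m.-tuple R => kernw s z y).
Proof.
pose c (j : freq m s.*2) : R[i] := \prod_(i < m)
  ((kernhat R s ((j i : int) - (s.*2 : int)) / N%:R)%:C *
   cexp (- (((j i)%:R - (s.*2)%:R) * ((y i)%:R / N%:R)))).
exists c => z; rewrite /kernw rmorph_prod /=.
under eq_bigr => i _.
  rewrite realcM kern_fourier mulr_suml; over.
rewrite bigA_distr_bigA /=; apply: eq_bigr => j _.
rewrite /c /phase cexp_sum -big_split /=; apply: eq_bigr => i _.
by rewrite mulrBr cexpD [(kernhat _ _ _ / _)%:C]realcM; ring.
Qed.

End TrigonometricPolynomials.

(** * Sums of squares and their Gram matrices *)

Section SumsOfSquares.
Variables (R : realType).
Implicit Types (m s : nat).

Definition sos m s (g : m.-tuple R -> R) := exists W : 'M[R]_(msize m s),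
  psd W /\ forall z, g z = (mvec s z *m W *m (mvec s z)^T) 0 0.

Lemma sos0 m s : sos s (fun _ : m.-tuple R => 0).
Proof.
exists 0; split; first by split=> [|v]; rewrite ?trmx0// mulmx0 mul0mx mxE.
by move=> z; rewrite mulmx0 mul0mx mxE.
Qed.

Lemma sosD m s (g h : m.-tuple R -> R) : sos s g -> sos s h ->
  sos s (fun z => g z + h z).
Proof.
move=> [W [[Wt W0] gE]] [V [[Vt V0] hE]]; exists (W + V); split.
  split=> [|v]; first by rewrite linearD /= Wt Vt.
  by rewrite mulmxDr mulmxDl mxE addr_ge0.
by move=> z; rewrite mulmxDr mulmxDl mxE gE hE.
Qed.

Lemma sosZ m s (a : R) (g : m.-tuple R -> R) : 0 <= a -> sos s g ->
  sos s (fun z => a * g z).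
Proof.
move=> a0 [W [[Wt W0] gE]]; exists (a *: W); split.
  split=> [|v]; first by rewrite linearZ /= Wt.
  by rewrite -scalemxAr -scalemxAl mxE mulr_ge0.
by move=> z; rewrite -scalemxAr -scalemxAl mxE gE.
Qed.

Lemma sos_sum m s (I : finType) (g : I -> m.-tuple R -> R) :
  (forall i, sos s (g i)) -> sos s (fun z => \sum_i g i z).
Proof.
move=> gs; elim: (index_enum I) => [|i r IH].
  have := @sos0 m s; congr sos; apply/funext => z; by rewrite big_nil.
by have := sosD (gs i) IH; congr sos; apply/funext => z; rewrite big_cons.
Qed.

(** The Gram matrix is the rank-one [u *m u^T], with [u] the coefficients listed in the order of
    [mvec]. *)
Lemma sos_sqr m s (a b : freq m s -> R) : sos s (fun z =>
  (\sum_j (a j * cos (2 * pi * phase j z) + b j * sin (2 * pi * phase j z))) ^+ 2).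
Proof.
pose F (p : freq m s * bool) := if p.2 then a p.1 else b p.1.
pose u : 'cV[R]_(msize m s) := \col_j F (enum_val j).
have mu z : (mvec s z *m u) 0 0 =
  \sum_j (a j * cos (2 * pi * phase j z) + b j * sin (2 * pi * phase j z)).
  rewrite mxE.
  transitivity (\sum_(p : freq m s * bool) F p *
     (if p.2 then cos (2 * pi * phase p.1 z) else sin (2 * pi * phase p.1 z))).
    rewrite [RHS](reindex (enum_val : 'I_(msize m s) -> freq m s * bool)) /=; last first.
      by apply: onW_bij; exact: enum_val_bij.
    apply: eq_bigr => i _.
    by rewrite !mxE mulrC; case: (enum_val i) => p [].
  transitivity (\sum_(j : freq m s) \sum_(e : bool) F (j, e) *
     (if e then cos (2 * pi * phase j z) else sin (2 * pi * phase j z))).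
    by rewrite pair_bigA; apply: eq_bigr => -[].
  by apply: eq_bigr => j _; rewrite big_bool.
exists (u *m u^T).
have sq v : (v *m (u *m u^T) *m v^T) 0 0 = ((v *m u) 0 0) ^+ 2.
  rewrite mulmxA -mulmxA -trmx_mul mxE big_ord1 [X in _ * X]mxE expr2//.
split; last by move=> z; rewrite sq mu.
by split=> [|v]; rewrite ?trmx_mul ?trmxK// sq sqr_ge0.
Qed.

Lemma sos_normsq m s (c : freq m s -> R[i]) : sos s (fun z =>
  complex.Re (\sum_j c j * cexp (phase j z)) ^+ 2 +
  complex.Im (\sum_j c j * cexp (phase j z)) ^+ 2).
Proof.
have := sosD (sos_sqr (fun j => complex.Re (c j)) (fun j => - complex.Im (c j)))
             (sos_sqr (fun j => complex.Im (c j)) (fun j => complex.Re (c j))).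
congr sos; apply/funext => z /=; rewrite Re_sum Im_sum.
by congr (_ ^+ 2 + _ ^+ 2); apply: eq_bigr => j _; case: (c j) => p q /=; ring.
Qed.

(** A product of squared moduli is the squared modulus of the product, a single polynomial in all
    variables. The offset [j - s] in [freqpoly] is the one of [phase], so its frequencies stay
    within [s]. *)
Lemma sos_kernw m s N (y : {ffun 'I_m -> 'I_N}) :
  sos s (fun z : m.-tuple R => kernw s z y).
Proof.
pose c (j : freq m s) : R[i] := \prod_(i < m)
  ((sinwt R s (j i))%:C * cexp (- (((j i)%:R - s%:R) * ((y i)%:R / N%:R)))).
have cE (z : m.-tuple R) : \prod_(i < m) freqpoly s (tnth z i - (y i)%:R / N%:R) =
    \sum_j c j * cexp (phase j z).
  rewrite bigA_distr_bigA /=; apply: eq_bigr => j _.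
  rewrite /c /phase cexp_sum -big_split /=; apply: eq_bigr => i _.
  rewrite mulrBr cexpD; ring.
have Q0 : 0 <= \prod_(i < m) ((sinwt_norm R s)^-1 / N%:R).
  by apply: prodr_ge0 => i _; rewrite divr_ge0// invr_ge0 ltW// sinwt_norm_gt0.
have := sosZ Q0 (sos_normsq c).
pose nsq (a : R[i]) := complex.Re a ^+ 2 + complex.Im a ^+ 2.
have nsqM : {morph nsq : a b / a * b} by move=> [a b] [p q]; rewrite /nsq /=; ring.
have nsq1 : nsq 1 = 1 by rewrite /nsq /= expr1n expr0n addr0.
congr sos; apply/funext => z; rewrite -cE -/(nsq _) (big_morph nsq nsqM nsq1).
by rewrite -big_split; apply: eq_bigr => i _; rewrite /= mulrC mulrA.
Qed.

End SumsOfSquares.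

(** * Coefficients recovered from iterated integrals *)

Section FourierCoefficients.
Variable R : realType.
Implicit Types (m k : nat).

Lemma is_derive_sin_cos (p q w x : R) :
  is_derive x 1 (fun t : R => p * sin (w * t) + q * cos (w * t))
    (w * p * cos (w * x) - w * q * sin (w * x)).
Proof.
have hw : is_derive x 1 (fun t : R => w * t) w.
  by apply: (is_derive_eq (is_deriveZ w (is_derive_id x 1))); rewrite [LHS]mulr1.
have hs : is_derive x 1 (fun t : R => sin (w * t)) (cos (w * x) * w).
  exact: (is_derive1_comp (is_derive_sin (w * x)) hw).
have hc : is_derive x 1 (fun t : R => cos (w * t)) (- sin (w * x) * w).
  exact: (is_derive1_comp (is_derive_cos (w * x)) hw).
apply: (is_derive_eq (is_deriveD (is_deriveZ p hs) (is_deriveZ q hc))).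
by rewrite /GRing.scale /=; ring.
Qed.

Lemma continuous_sin_cos (p q w : R) :
  continuous (fun t : R => p * sin (w * t) + q * cos (w * t)).
Proof.
move=> x; apply: differentiable_continuous; apply/derivable1_diffP.
by have [] := is_derive_sin_cos p q w x.
Qed.

Lemma Re_cexpE (c : R[i]) (a : R) : (fun t : R => complex.Re (c * cexp (a * t))) =
  (fun t => - complex.Im c * sin (2 * pi * a * t) + complex.Re c * cos (2 * pi * a * t)).
Proof. by apply/funext => t; case: c => p q /=; rewrite mulrA; ring. Qed.

Lemma continuous_Re_cexp (c : R[i]) (a : R) :
  continuous (fun t : R => complex.Re (c * cexp (a * t))).
Proof. rewrite Re_cexpE; exact: continuous_sin_cos. Qed.

Lemma Rintegral_cexp (c : R[i]) (k : int) :
  Rintegral (@lebesgue_measure R) `[0%R, 1%R]%classic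
    (fun t => complex.Re (c * cexp (k%:~R * t))) = if k == 0 then complex.Re c else 0.
Proof.
case: eqP => [->|/eqP k0].
  rewrite (_ : (fun t => _) = fun=> complex.Re c); last first.
    by apply/funext => t; rewrite mul0r cexp0 mulr1.
  by rewrite Rintegral_cst//= lebesgue_measure_itv /= lte01 /= subr0 mulr1.
have w0 : 2 * pi * k%:~R != 0 :> R by rewrite !mulf_neq0 ?intr_eq0// gt_eqF// pi_gt0.
set w := 2 * pi * k%:~R in w0.
(* The real part of [c * cexp (k t) / (i w)], an antiderivative of the integrand. *)
pose F t : R := complex.Re c / w * sin (w * t) + complex.Im c / w * cos (w * t).
have dF (x : R) : is_derive x 1 F (complex.Re (c * cexp (k%:~R * x))).
  apply: (is_derive_eq (is_derive_sin_cos _ _ _ _)).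
  rewrite [X in _ = X](congr1 (@^~ x) (Re_cexpE c _)) -/w.
  by field.
have cF : continuous F by exact: continuous_sin_cos.
rewrite /Rintegral (@continuous_FTC2 _ _ F)//.
- rewrite /F mulr0 mulr1 sin0 cos0.
  have := cexp_int R k; rewrite /cexp -/w => -[-> ->].
  by rewrite !mulr0 subee.
- by apply: continuous_subspaceT; exact: continuous_Re_cexp.
- split.
  + by move=> x _; have [] := dF x.
  + by apply: cvg_at_right_filter; exact: cF.
  + by apply: cvg_at_left_filter; exact: cF.
- by move=> x _; rewrite derive1E; have [_] := dF x.
Qed.

Lemma Rintegral_sum_cexp (J : finType) (c : J -> R[i]) (k : J -> int) :
  Rintegral (@lebesgue_measure R) `[0%R, 1%R]%classic
    (fun t => \sum_j complex.Re (c j * cexp ((k j)%:~R * t))) =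
  \sum_j if k j == 0 then complex.Re (c j) else 0.
Proof.
have int1 j : (@lebesgue_measure R).-integrable `[0%R, 1%R]%classic
    (EFin \o (fun t => complex.Re (c j * cexp ((k j)%:~R * t)))).
  apply: continuous_compact_integrable; first exact: segment_compact.
  by apply: continuous_subspaceT; exact: continuous_Re_cexp.
elim: (index_enum J) => [|j r IH].
  by under eq_Rintegral do rewrite big_nil; rewrite Rintegral_cst//= mul0r big_nil.
under eq_Rintegral do rewrite big_cons.
rewrite RintegralD//; first by rewrite big_cons IH Rintegral_cexp.
have := @integrable_sum _ _ _ (@lebesgue_measure R) `[0%R, 1%R]%classic
  (measurable_itv _) _ r xpredT _ (fun j _ => int1 j).
by congr (_.-integrable); apply/funext => t /=; rewrite sumEFin.
Qed.

Lemma eq_iint_seq m (h h' : seq R -> R) :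
  (forall l, size l = m -> h l = h' l) -> iint_seq m h = iint_seq m h'.
Proof.
elim: m h h' => [|m IH] h h' hh' /=; first exact: hh'.
congr Rintegral; apply/funext => t; apply: IH => l lm.
by apply: hh'; rewrite /= lm.
Qed.

(** For the inner integrals the exponential of the first variable is a constant, absorbed into the
    coefficient. Frequencies are indexed by [nat] so that dropping a variable is a mere shift of the
    index. *)
Lemma iint_seq_cexp m (J : finType) (c : J -> R[i]) (k : J -> nat -> int) :
  iint_seq m (fun l => \sum_j complex.Re (c j *
     cexp (\sum_(i < m) (k j i)%:~R * nth 0 l i))) =
  \sum_j if [forall i : 'I_m, k j i == 0] then complex.Re (c j) else 0.
Proof.
elim: m c k => [|m IH] c k.
  rewrite /=; apply: eq_bigr => j _; rewrite big_ord0 cexp0 mulr1 ifT//.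
  by apply/forallP => -[].
pose z j := [forall i : 'I_m, k j i.+1 == 0].
transitivity (Rintegral (@lebesgue_measure R) `[0%R, 1%R]%classic (fun t =>
    \sum_j complex.Re ((if z j then c j else 0) * cexp ((k j 0%N)%:~R * t)))).
  rewrite [LHS]/=; congr Rintegral; apply/funext => t.
  transitivity (iint_seq m (fun l => \sum_j complex.Re (c j * cexp ((k j 0%N)%:~R * t) *
     cexp (\sum_(i < m) (k j i.+1)%:~R * nth 0 l i)))).
    congr iint_seq; apply/funext => l; apply: eq_bigr => j _.
    by rewrite big_ord_recl /= cexpD mulrA.
  rewrite (IH _ (fun j i => k j i.+1)); apply: eq_bigr => j _.
  by rewrite -/(z j); case: ifP; rewrite ?mul0r.
rewrite Rintegral_sum_cexp; apply: eq_bigr => j _.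
have -> : [forall i : 'I_m.+1, k j i == 0] = (k j 0%N == 0) && z j.
  apply/forallP/andP => [k0|[k0 /forallP zj] i].
    by split; [exact: (k0 ord0)|apply/forallP => i; exact: (k0 (lift ord0 i))].
  by case: (unliftP ord0 i) => [i' ->|-> //]; exact: zj.
by case: (k j 0%N == 0); case: (z j).
Qed.

Lemma cube_integral_cexp m (J : finType) (c : J -> R[i]) (zh : J -> {ffun 'I_m -> int}) :
  cube_integral (fun z => \sum_j complex.Re (c j * cexp (zphase (zh j) z))) =
  \sum_j if zh j == [ffun=> 0] then complex.Re (c j) else 0.
Proof.
pose k j i := if insub i is Some i' then zh j i' else 0.
have kE j (i : 'I_m) : k j i = zh j i by rewrite /k valK.
transitivity (iint_seq m (fun l => \sum_j complex.Re (c j *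
     cexp (\sum_(i < m) (k j i)%:~R * nth 0 l i)))).
  apply: eq_iint_seq => l lm; apply: eq_bigr => j _; congr (complex.Re (_ * cexp _)).
  apply: eq_bigr => i _; rewrite kE (tnth_nth 0); congr (_ * nth _ _ _).
  by rewrite val_insubd lm eqxx.
rewrite iint_seq_cexp; apply: eq_bigr => j _; congr (if _ then _ else _).
apply/forallP/eqP => [k0|z0 i]; last by rewrite kE z0 ffunE.
by apply/ffunP => i; rewrite ffunE -kE; apply/eqP.
Qed.

Definition zfreq m k (j : freq m k) : {ffun 'I_m -> int} := [ffun i => (j i : int) - (k : int)].

Lemma zphase_zfreq m k (j : freq m k) (z : m.-tuple R) : zphase (zfreq j) z = phase j z.
Proof. by apply: eq_bigr => i _; rewrite ffunE rmorphB /= !pmulrn. Qed.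

Lemma zphaseB m (a b : {ffun 'I_m -> int}) (z : m.-tuple R) :
  zphase [ffun i => a i - b i] z = zphase a z - zphase b z.
Proof.
by rewrite /zphase -sumrB; apply: eq_bigr => i _; rewrite ffunE rmorphB mulrBl.
Qed.

Lemma zfreq_inj m k : injective (@zfreq m k).
Proof.
move=> a b /ffunP ab; apply/ffunP => i; apply: val_inj.
by have := ab i; rewrite !ffunE => /addIr [].
Qed.

Lemma zfreq_le m k (j : freq m k) i : (`|zfreq j i| <= k)%N.
Proof. by rewrite ffunE; have := ltn_ord (j i); lia. Qed.

(** The factor shifts all frequencies by that of [j0]; by injectivity of [zfreq] only [j0] lands on
    the zero frequency, the only one with nonzero integral. *)
Lemma cube_integral_shift m k (c : freq m k -> R[i]) (j0 : freq m k) :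
  cube_integral (fun z : m.-tuple R =>
    complex.Re ((\sum_j c j * cexp (phase j z)) * cexp (- zphase (zfreq j0) z)))
  = complex.Re (c j0).
Proof.
rewrite (_ : (fun z => _) = fun z => \sum_j complex.Re (c j *
    cexp (zphase [ffun i => zfreq j i - zfreq j0 i] z))); last first.
  apply/funext => z; rewrite mulr_suml Re_sum; apply: eq_bigr => j _.
  by rewrite zphaseB cexpD !zphase_zfreq mulrA.
rewrite cube_integral_cexp (bigD1 j0)//= ifT; last first.
  by apply/eqP/ffunP => i; rewrite !ffunE subrr.
rewrite big1 ?addr0// => j jj0; rewrite ifF//; apply/eqP => /ffunP e.
case/eqP: jj0; apply: zfreq_inj; apply/ffunP => i.
by have := e i; rewrite !ffunE => /eqP; rewrite subr_eq0 => /eqP.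
Qed.

Lemma fourier_coef m k (g : m.-tuple R -> R) (c : freq m k -> R[i]) (j : freq m k) :
  (forall z, (g z)%:C = \sum_j c j * cexp (phase j z)) ->
  fourier_re g (zfreq j) = complex.Re (c j) /\ fourier_im g (zfreq j) = complex.Im (c j).
Proof.
move=> gE; split.
  rewrite -(cube_integral_shift c j); congr cube_integral; apply/funext => z.
  by rewrite -gE Re_realM /= mulrN cosN.
(* The imaginary part reduces to the real case for the coefficients ['i * c]. *)
have -> : complex.Im (c j) = - complex.Re ('i * c j) by case: (c j) => a b /=; ring.
rewrite -(cube_integral_shift (fun j => 'i * c j) j); congr (- _).
congr cube_integral; apply/funext => z.
under [in RHS]eq_bigr do rewrite -mulrA.
by rewrite -mulr_sumr -gE /= mulrN cosN sinN; ring.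
Qed.

Lemma fourier_le_Fnorm m (g : m.-tuple R -> R) (A : R) (zh : {ffun 'I_m -> int}) :
  (Fnorm g <= A%:E)%E ->
  Num.sqrt (fourier_re g zh ^+ 2 + fourier_im g zh ^+ 2) <= A.
Proof.
move=> gA; rewrite -lee_fin; apply: le_trans gA; apply: esum_ge.
exists [set zh]; last by rewrite fsbig_set1.
by split=> //; exact: finite_set1.
Qed.

Lemma trig_coef_le m k (g : m.-tuple R -> R) (c : freq m k -> R[i]) (A : R) (j : freq m k) :
  (forall z, (g z)%:C = \sum_j c j * cexp (phase j z)) -> (Fnorm g <= A%:E)%E ->
  `|complex.Re (c j)| <= A /\ `|complex.Im (c j)| <= A.
Proof.
move=> gE gA; have := fourier_le_Fnorm (zfreq j) gA.
have [-> ->] := fourier_coef j gE.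
move=> hA; split; apply: le_trans hA; rewrite -sqrtr_sqr ler_wsqrtr//.
  by rewrite lerDl sqr_ge0.
by rewrite lerDr sqr_ge0.
Qed.

End FourierCoefficients.

(** * Bounds and periodicity of the partial minimum *)

Section ParametricMinimum.
Variables (R : realType) (n d : nat).
Implicit Types (x : n.-tuple R) (w : d.-tuple R) (f : (n + d).-tuple R -> R).

Lemma Re_cexp_le (c : R[i]) (t : R) :
  `|complex.Re (c * cexp t)| <= `|complex.Re c| + `|complex.Im c|.
Proof.
case: c => a b /=; rewrite (le_trans (ler_normB _ _))// !normrM.
by rewrite lerD// ler_piMr ?cos_max ?sin_max.
Qed.

Lemma ctrig_bounded m k (g : m.-tuple R -> R) : ctrig k g ->
  exists M, forall z, `|g z| <= M.
Proof.
move=> [c gE]; exists (\sum_j (`|complex.Re (c j)| + `|complex.Im (c j)|)) => z.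
have -> : g z = complex.Re (\sum_j c j * cexp (phase j z)) by rewrite -gE.
rewrite Re_sum (le_trans (ler_norm_sum _ _ _))//.
by apply: ler_sum => j _; exact: Re_cexp_le.
Qed.

Lemma ctrig_periodic m k (g : m.-tuple R -> R) : ctrig k g -> periodic1 g.
Proof.
move=> [c gE] w w' ww'; apply: (@complexI R); rewrite !gE.
apply: eq_bigr => j _; congr (_ * _); rewrite /phase !cexp_sum.
apply: eq_bigr => i _; have [l ->] := ww' i.
rewrite mulrDr cexpD (_ : _ * l%:~R = (((j i : int) - (k : int)) * l)%:~R).
  by rewrite cexp_int mulr1.
by rewrite rmorphM rmorphB /= !pmulrn.
Qed.

(** The bound on [f] makes the set of values bounded below, so that [inf] is a genuine infimum. *)
Lemma cstar_le f x w : (exists M, forall z, `|f z| <= M) -> cube n x ->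
  cstar f w <= f (pt x w).
Proof.
move=> [M fM] cx; apply: ge_inf; last by exists x.
by exists (- M) => _ [y _ <-]; have := fM (pt y w); rewrite ler_norml => /andP[].
Qed.

Lemma cube0 m : cube m (nseq_tuple m (0 : R)).
Proof. by move=> i; rewrite tnth_nseq lexx ler01. Qed.

Lemma le_cstar f (a : R) w : (forall x, cube n x -> a <= f (pt x w)) -> a <= cstar f w.
Proof.
move=> af; apply: lb_le_inf; last by move=> _ [x cx <-]; exact: af.
by exists (f (pt (nseq_tuple n 0) w)), (nseq_tuple n 0) => //; exact: cube0.
Qed.

Lemma cstar_bounded f : (exists M, forall z, `|f z| <= M) ->
  exists M, forall w, `|cstar f w| <= M.
Proof.
move=> fb; have [M fM] := fb; exists M => w; rewrite ler_norml; apply/andP; split.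
  by apply: le_cstar => x _; have := fM (pt x w); rewrite ler_norml => /andP[].
apply: (le_trans (cstar_le w fb (@cube0 n))).
by have := fM (pt (nseq_tuple n 0) w); rewrite ler_norml => /andP[].
Qed.

Lemma cstar_periodic f : periodic1 f -> periodic1 (cstar f).
Proof.
move=> pf w w' ww'; congr inf; apply: eq_imagel => x _; apply: pf => i.
case: (split_ordP i) => j ->; rewrite ?tnth_lshift ?tnth_rshift; last exact: ww'.
by exists 0; rewrite addr0.
Qed.

End ParametricMinimum.

(** * The sum-of-squares certificate obtained by deconvolution *)

Section Certificate.
Variables (R : realType) (n d r s : nat).
Variables (f : (n + d).-tuple R -> R) (c : freq (n + d) r.*2 -> R[i]).
Hypothesis fE : forall z, (f z)%:C = \sum_j c j * cexp (phase j z).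

(** The kernel has frequencies up to [2 s] and [f] up to [2 r]. The second extra point gives
    [2 s + 1 < N] even for [r = 0], as the first moment requires. *)
Let N := ((s + r).*2).+2.

Definition kernhat_prod (j : freq (n + d) r.*2) : R :=
  \prod_(i < n + d) kernhat R s (zfreq j i).

Let grid := ({ffun 'I_n -> 'I_N} * {ffun 'I_d -> 'I_N})%type.

(** Pairs keep the grids in [x] and [w] separate for summation, while [sos_kernw] needs one grid
    index in all [n + d] variables. *)
Definition joinpt (p : grid) : {ffun 'I_(n + d) -> 'I_N} :=
  [ffun i => match fintype.split i with inl a => p.1 a | inr b => p.2 b end].

Lemma kernw_joinpt (x : n.-tuple R) (w : d.-tuple R) (p : grid) :
  kernw s (pt x w) (joinpt p) = kernw s x p.1 * kernw s w p.2.
Proof.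
by apply: kernw_cat => i; rewrite ffunE; [rewrite (unsplitK (inl i))|rewrite (unsplitK (inr i))].
Qed.

Lemma phase_pt (j : freq (n + d) r.*2) (x : n.-tuple R) (w : d.-tuple R) :
  phase j (pt x w) = \sum_(i < n) (zfreq j (lshift d i))%:~R * tnth x i +
                     \sum_(i < d) (zfreq j (rshift n i))%:~R * tnth w i.
Proof.
rewrite -zphase_zfreq /zphase big_split_ord /=.
by congr (_ + _); apply: eq_bigr => i _; rewrite ?tnth_lshift ?tnth_rshift.
Qed.

Lemma sum_kernw_phase (x : n.-tuple R) (w : d.-tuple R) (j : freq (n + d) r.*2) :
  \sum_(p : grid) (kernw s x p.1 * kernw s w p.2)%:C *
     cexp (phase j (pt (gridpt R p.1) (gridpt R p.2))) =
  (kernhat_prod j)%:C * cexp (phase j (pt x w)).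
Proof.
have bnd i : (s.*2 + `|zfreq j i| < N)%N by have := zfreq_le j i; rewrite /N; lia.
have ex := @kernw_eigen R s N n (fun i => zfreq j (lshift d i)) x (fun i => bnd _).
have ew := @kernw_eigen R s N d (fun i => zfreq j (rshift n i)) w (fun i => bnd _).
rewrite phase_pt cexpD /kernhat_prod big_split_ord /= realcM mulrACA -ex -ew.
rewrite mulr_suml.
under [RHS]eq_bigr do rewrite mulr_sumr.
rewrite pair_bigA /=; apply: eq_bigr => -[yx yw] _ /=.
by rewrite phase_pt cexpD realcM mulrACA.
Qed.

(* The preimage of [f] under convolution with the kernel. *)
Definition deconv (z : (n + d).-tuple R) : R :=
  complex.Re (\sum_j ((kernhat_prod j)^-1)%:C * c j * cexp (phase j z)).

Hypothesis kernhat_prod_gt0 : forall j, 0 < kernhat_prod j.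

Lemma sum_kernw_deconv (x : n.-tuple R) (w : d.-tuple R) :
  \sum_(p : grid) kernw s x p.1 * kernw s w p.2 *
    deconv (pt (gridpt R p.1) (gridpt R p.2)) = f (pt x w).
Proof.
have -> : f (pt x w) = complex.Re (\sum_j c j * cexp (phase j (pt x w))) by rewrite -fE.
under eq_bigr => p _ do rewrite -Re_realM mulr_sumr.
rewrite -Re_sum exchange_big /=; congr complex.Re; apply: eq_bigr => j _.
transitivity (((kernhat_prod j)^-1)%:C * c j * ((kernhat_prod j)%:C * cexp (phase j (pt x w)))).
  by rewrite -sum_kernw_phase mulr_sumr; apply: eq_bigr => p _; ring.
by rewrite mulrACA -realcM mulVf ?gt_eqF// (_ : 1%:C = 1)// mul1r.
Qed.

(** The difference is the convolution of [deconv - g + e]. Its values at grid points, which lie in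
    the cube, are nonnegative coefficients of kernels that are themselves sums of squares. *)
Lemma sos_certificate (g : d.-tuple R -> R) (e : R) :
  (forall x w, cube n x -> cube d w -> g w - e <= deconv (pt x w)) ->
  exists W : 'M[R]_(msize (n + d) s), psd W /\
    forall x w, f (pt x w) - (\sum_(y : {ffun 'I_d -> 'I_N}) kernw s w y * g (gridpt R y) - e)
      = (mvec s (pt x w) *m W *m (mvec s (pt x w))^T) 0 0.
Proof.
move=> ge.
pose h (p : grid) := deconv (pt (gridpt R p.1) (gridpt R p.2)) - (g (gridpt R p.2) - e).
have h0 p : 0 <= h p by rewrite subr_ge0; apply: ge; exact: gridpt_cube.
have [W [Wpsd WE]] := sos_sum (fun p => sosZ (h0 p) (@sos_kernw R _ s N (joinpt p))).
exists W; split=> // x w; rewrite -WE.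
have sN : (s.*2 < N)%N by rewrite /N; lia.
rewrite -sum_kernw_deconv.
have -> : \sum_(y : {ffun 'I_d -> 'I_N}) kernw s w y * g (gridpt R y) - e =
    \sum_(p : grid) kernw s x p.1 * kernw s w p.2 * (g (gridpt R p.2) - e).
  (* The weights in [x] sum to 1, so averaging over [x] as well leaves a function of [w]
     unchanged. *)
  transitivity (\sum_(yx : {ffun 'I_n -> 'I_N}) \sum_(yw : {ffun 'I_d -> 'I_N})
      kernw s x yx * (kernw s w yw * (g (gridpt R yw) - e))).
    under [RHS]eq_bigr do rewrite -mulr_sumr.
    rewrite -mulr_suml sum_kernw// mul1r.
    under [RHS]eq_bigr do rewrite mulrBr.
    by rewrite sumrB -mulr_suml sum_kernw// mul1r.
  by rewrite pair_bigA; apply: eq_bigr => p _; rewrite mulrA.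
rewrite -sumrB; apply: eq_bigr => p _.
by rewrite kernw_joinpt -mulrBr mulrC.
Qed.

End Certificate.

(** * Quantitative bounds for the deconvolution *)

Section Deconvolution.
Variables (R : realType) (n d r s : nat).

Lemma kernhat_le1 (k : int) : kernhat R s k <= 1.
Proof.
pose N := (s.*2 + `|k| + 1)%N.
rewrite -(@sum_kern_cos R s N k 0); last by rewrite /N; lia.
rewrite -[leRHS](@sum_kern R s N 0); last by rewrite /N; lia.
by apply: ler_sum => y _; rewrite ler_piMr ?kern_div_ge0 ?cos_le1.
Qed.

(** Induction on [1 - a p = (1 - a) + a (1 - p) <= (1 - a) + (1 - p)], which needs the bounds 0 and
    1 on the partial product [p]. *)
Lemma oneBprod_le m (a : 'I_m -> R) : (forall i, 0 <= a i <= 1) ->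
  0 <= 1 - \prod_(i < m) a i <= \sum_(i < m) (1 - a i).
Proof.
move=> a01.
suff : 0 <= \prod_(i < m) a i <= 1 /\ 1 - \prod_(i < m) a i <= \sum_(i < m) (1 - a i).
  by move=> [/andP[_ ? ?]]; rewrite subr_ge0; apply/andP.
elim/big_rec2: _ => [|i p q _ [/andP[p0 p1] pq]]; first by rewrite ler01 lexx subrr.
have /andP[ai0 ai1] := a01 i; rewrite mulr_ge0//= mulr_ile1//; split=> //; nra.
Qed.

(** The bound of [oneBkernhat_le] at the extreme frequency [2 r], hence valid for every coordinate
    frequency of [f]. *)
Definition kernhat_defect : R := (r.*2)%:R ^+ 2 * (pi ^+ 2 / s.*2.+2%:R ^+ 2 / 2).

Lemma kernhat_defect_ge0 : 0 <= kernhat_defect.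
Proof. by rewrite mulr_ge0 ?sqr_ge0// divr_ge0// divr_ge0 ?sqr_ge0. Qed.

Lemma oneBkernhat_zfreq m (j : freq m r.*2) i : 1 - kernhat R s (zfreq j i) <= kernhat_defect.
Proof.
apply: (le_trans (oneBkernhat_le _ _ _)); rewrite ler_wpM2r//.
  by rewrite !divr_ge0 ?sqr_ge0.
have := zfreq_le j i; case: (zfreq j i) => k /= hk.
  by rewrite ler_sqr ?nnegrE// ler_nat.
by rewrite NegzE mulrNz sqrrN ler_sqr ?nnegrE// ler_nat.
Qed.

(** Once the product [P] is at least 1/2, [1 / P - 1 = (1 - P) / P <= 2 (1 - P)]. *)
Lemma kernhat_prod_bounds (j : freq (n + d) r.*2) :
  (n + d)%:R * kernhat_defect <= 1 / 2 -> kernhat_defect <= 1 ->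
  1 / 2 <= kernhat_prod R s j /\
  0 <= (kernhat_prod R s j)^-1 - 1 <= 2 * ((n + d)%:R * kernhat_defect).
Proof.
move=> D1 D2; set P := kernhat_prod R s j.
have k01 i : 0 <= kernhat R s (zfreq j i) <= 1.
  by rewrite kernhat_le1 andbT; have := oneBkernhat_zfreq j i; lra.
have /andP[P1 Ple] : 0 <= 1 - P <= \sum_(i < n + d) (1 - kernhat R s (zfreq j i)).
  exact: oneBprod_le.
have sumle : \sum_(i < n + d) (1 - kernhat R s (zfreq j i)) <= (n + d)%:R * kernhat_defect.
  apply: (@le_trans _ _ (\sum_(i < n + d) kernhat_defect)).
    by apply: ler_sum => i _; exact: oneBkernhat_zfreq.
  by rewrite sumr_const card_ord -[leLHS]mulr_natl.
have P12 : 1 / 2 <= P by lra.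
split=> //.
have P0 : 0 < P by lra.
have -> : P^-1 - 1 = (1 - P) / P by field; rewrite gt_eqF.
rewrite divr_ge0//=; last by rewrite ltW.
rewrite ler_pdivrMr//; nra.
Qed.

Lemma kernhat_prod_freq0 : kernhat_prod R s (freq0 (n + d) r.*2) = 1.
Proof.
by apply: big1 => i _; rewrite ffunE freq0E subrr kernhat0.
Qed.

(** The zero frequency has multiplier 1 and is left intact, so only the other coefficients need a
    bound. In the constant 4, one factor 2 comes from [1 / P - 1] and one from adding real and
    imaginary parts. *)
Lemma deconv_close (c : freq (n + d) r.*2 -> R[i]) (A : R) z :
  (n + d)%:R * kernhat_defect <= 1 / 2 -> kernhat_defect <= 1 ->
  (forall j, j != freq0 _ _ -> `|complex.Re (c j)| <= A /\ `|complex.Im (c j)| <= A) ->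
  complex.Re (\sum_j c j * cexp (phase j z)) -
    #|{: freq (n + d) r.*2}|%:R * (4 * (n + d)%:R * `|A| * kernhat_defect)
    <= deconv s c z.
Proof.
move=> D1 D2 cA; rewrite lerBlDr -lerBlDl /deconv !Re_sum -sumrB.
set X := 4 * _ * _ * _.
have X0 : 0 <= X by rewrite mulr_ge0 ?kernhat_defect_ge0// !mulr_ge0.
apply: (@le_trans _ _ (\sum_(j : freq (n + d) r.*2) X)); last first.
  by rewrite sumr_const -[leLHS]mulr_natl.
apply: ler_sum => j _; rewrite -mulrA Re_realM.
have [-> |j0] := eqVneq j (freq0 (n + d) r.*2).
  by rewrite kernhat_prod_freq0 invr1 mul1r subrr.
have [_ /andP[q0 q1]] := kernhat_prod_bounds j D1 D2.
have [cA1 cA2] := cA j j0.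
have := Re_cexp_le (c j) (phase j z); set t := complex.Re (c j * _) => tle.
have t2 : `|t| <= 2 * `|A| by have := ler_norm A; lra.
set q := _^-1 in q0 q1 *.
have -> : t - q * t = (q - 1) * (- t) by ring.
apply: (@le_trans _ _ ((q - 1) * (2 * `|A|))).
  by rewrite ler_wpM2l// (le_trans _ t2)// -normrN ler_norm.
apply: (@le_trans _ _ ((2 * ((n + d)%:R * kernhat_defect)) * (2 * `|A|))).
  by rewrite ler_wpM2r// mulr_ge0.
by rewrite /X; lra.
Qed.

End Deconvolution.

(** * Measurability and integrability on the cube *)

Section Measurability.
Variables (R : realType) (d : nat).

Lemma measurable_cube : measurable (cube d : set (d.-tuple R)).
Proof.
rewrite (_ : cube d = \bigcap_(i in [set: 'I_d]) ((@tnth _ R ^~ i) @^-1` `[0, 1]%classic)).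
  apply: fin_bigcap_measurable; first exact: finite_finset.
  by move=> i _; rewrite -[X in measurable X]setTI; apply: measurable_tnth.
apply/seteqP; split=> [z cz i _|z cz i]; first by rewrite /= in_itv /=; exact: cz.
by have := cz i I; rewrite /= in_itv.
Qed.

Lemma measurable_ctrig k (g : d.-tuple R -> R) : ctrig k g -> measurable_fun setT g.
Proof.
move=> /trigpolyP[a [b gE]].
rewrite (_ : g = fun z => \sum_j (a j * cos (2 * pi * phase j z) -
    b j * sin (2 * pi * phase j z))); last by apply/funext => z; have [] := gE z.
apply: measurable_sum => j.
have mp : measurable_fun setT (fun z : d.-tuple R => 2 * pi * phase j z).
  apply: measurable_funM => //; apply: measurable_sum => i.
  by apply: measurable_funM => //; exact: measurable_tnth.
apply: measurable_funB; apply: measurable_funM => //.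
  by apply: measurableT_comp mp; apply: continuous_measurable_fun; exact: continuous_cos.
by apply: measurableT_comp mp; apply: continuous_measurable_fun; exact: continuous_sin.
Qed.

Lemma ctrig_kernw_sum s N (c : d.-tuple R -> R) :
  ctrig s.*2 (fun z : d.-tuple R => \sum_(y : {ffun 'I_d -> 'I_N}) kernw s z y * c (gridpt R y)).
Proof.
apply: ctrig_sum => y.
by have := ctrigZ (c (gridpt R y)) (@ctrig_kernw R d s N y);
  congr ctrig; apply/funext => z; rewrite mulrC.
Qed.

Lemma measurable_lipschitz_periodic (c : d.-tuple R -> R) (L : R) : 0 <= L ->
  periodic1 c -> lipschitz_with c L -> measurable_fun setT c.
Proof.
move=> L0 pc lc.
(* [2 s + 2] is the smallest grid size that [kernw_approx] allows. *)
pose h s (z : d.-tuple R) := \sum_(y : {ffun 'I_d -> 'I_(s.*2.+2)}) kernw s z y * c (gridpt R y).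
apply: (@measurable_fun_cvg _ _ _ _ h) => [s|z _].
  exact: measurable_ctrig (ctrig_kernw_sum _ _ _).
pose K := L * d%:R * (pi ^+ 2 + 1).
have K0 : 0 <= K by rewrite !mulr_ge0// addr_ge0// sqr_ge0.
(* [K] may be 0, so the tolerance is divided by [K + 1]. *)
apply/cvgrPdist_le => e e0.
have e1 : 0 < e / (K + 1) by rewrite divr_gt0// ltr_wpDl.
near=> s.
rewrite distrC (le_trans (kernw_approx z L0 _ pc lc))// mulrA -/K.
have : s.+1%:R^-1 < e / (K + 1) by near: s; exact: (near_infty_natSinv_lt (PosNum e1)).
rewrite ltr_pdivlMr ?ltr_wpDl// => se.
by apply/ltW/(le_lt_trans _ se); rewrite mulrC ler_wpM2l ?invr_ge0// lerDl.
Unshelve. all: by end_near. Qed.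

Lemma integrable_cube (nu : probability (d.-tuple R) R) (g : d.-tuple R -> R) :
  measurable_fun setT g -> (exists M, forall z, `|g z| <= M) ->
  nu.-integrable (cube d) (EFin \o g).
Proof.
move=> mg [M gM]; apply: measurable_bounded_integrable; first exact: measurable_cube.
- by rewrite (le_lt_trans (probability_le1 _ measurable_cube))// ltry.
- exact: measurable_funTS.
- exists M; split; [exact: num_real|move=> x Mx z _].
  by rewrite /= (le_trans (gM z))// ltW.
Qed.

End Measurability.

(** * Choice of constants and the convergence rate *)

Theorem mainTheorem1 (R : realType) (n d r : nat) (hn : (0 < n)%N) (hd : (0 < d)%N)
    (A B L : R) :
  exists (C : R) (s0 : nat), 0 < C /\
  forall (f : (n + d).-tuple R -> R) (nu : probability (d.-tuple R) R),
    nu (cube d) = 1%E ->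
    trigpoly (r.*2) f ->
    (Fnorm (centered f) <= A%:E)%E ->
    (Fnorm (centered (cstar f)) <= B%:E)%E ->
    lipschitz_with (cstar f) L ->
    forall s : nat, (1 <= s)%N -> (s0 <= s)%N ->
      (psos f nu s <= (pstar f nu)%:E)%E /\
      ((pstar f nu)%:E <= psos f nu s + (C * (ln s%:R / s%:R))%:E)%E.
Proof.
pose D : R := (r.*2)%:R ^+ 2 * pi ^+ 2.
pose K : R := #|{: freq (n + d) r.*2}|%:R * (4 * (n + d)%:R * `|A|).
(* [K * D] pays for the deconvolution error, the second term for smoothing [cstar f], and 1 ensures
   positivity. *)
pose C : R := K * D + `|L| * d%:R * (pi ^+ 2 + 1) + 1.
have D0 : 0 <= D by rewrite mulr_ge0 ?sqr_ge0.
have K0 : 0 <= K by rewrite !mulr_ge0.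
have E0 : 0 <= `|L| * d%:R * (pi ^+ 2 + 1) :> R by rewrite !mulr_ge0// addr_ge0// sqr_ge0.
have C0 : 0 < C by rewrite /C ltr_wpDl// addr_ge0// mulr_ge0.
(* The three terms give in turn [ln s >= 1], [(n + d) * dl <= 1 / 2] and [dl <= 1]. *)
pose B0 : R := expR 1 + 2 * (n + d)%:R * D + D.
have nD : 0 <= (n + d)%:R * D by rewrite mulr_ge0.
have eD : 0 <= expR 1 :> R by rewrite expR_ge0.
have B00 : 0 <= B0 by rewrite /B0; lra.
exists C, (Num.bound B0); split=> // f nu nu1 ftrig fA _ fL s s1 s0.
have /trigpolyP fct := ftrig.
have fb := ctrig_bounded fct.
have cb := cstar_bounded fb.
have cper := cstar_periodic (ctrig_periodic fct).
have clip : lipschitz_with (cstar f) `|L|.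
  by move=> z z'; rewrite (le_trans (fL z z'))// ler_wpM2r ?sqrtr_ge0 ?ler_norm.
have cint : nu.-integrable (cube d) (EFin \o cstar f).
  by apply: integrable_cube cb; exact: measurable_lipschitz_periodic cper clip.
have mcube := @measurable_cube R d.
split.
  (* A feasible [c] lies below [f] on the cube, since the Gram form is nonnegative, hence below
     [cstar f]. *)
  apply: ge_ereal_sup => _ [c [/trigpolyP ct [W [[_ W0] fW]]] <-].
  rewrite lee_fin; apply: le_Rintegral => //.
    by apply: integrable_cube; [exact: measurable_ctrig ct|exact: ctrig_bounded ct].
  move=> w cw; apply: le_cstar => x cx; rewrite -subr_ge0 fW//; exact: W0.
have sB : B0 <= s%:R.
  by rewrite (le_trans (ltW (archi_boundP B00)))// ler_nat.
have spos : (0 : R) < s%:R by rewrite ltr0n.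
have lns : 1 <= ln s%:R :> R.
  rewrite -[leLHS]expRK ler_ln ?posrE ?expR_gt0//.
  by move: sB; rewrite /B0; lra.
pose dl := kernhat_defect R r s.
(* The defect is of order [s^-2]; the weaker order [1 / s] is enough here. *)
have dls : dl <= D / s%:R.
  have aux (a p q : R) : a * (p / q / 2) = a * p / (q * 2) by rewrite invfM !mulrA.
  rewrite /dl /kernhat_defect aux ler_wpM2l// lef_pV2 ?posrE ?mulr_gt0 ?exprn_gt0//.
  have -> : s.*2.+2%:R = 2 * s%:R + 2 :> R by rewrite -[s.*2.+2]addn2 natrD -mul2n natrM.
  nra.
have dl1 : dl <= 1.
  rewrite (le_trans dls)// ler_pdivrMr// mul1r; move: sB; rewrite /B0; lra.
have dl2 : (n + d)%:R * dl <= 1 / 2.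
  rewrite (le_trans (ler_wpM2l _ dls))// mulrA ler_pdivrMr//; move: sB; rewrite /B0; lra.
have [c fE] := fct.
pose eps := K * dl.
have coefA j : j != freq0 _ _ -> `|complex.Re (c j)| <= A /\ `|complex.Im (c j)| <= A.
  move=> j0.
  (* Centering [f] alters only its zero-frequency coefficient, so the others inherit the bound from
     the norm of [centered f]. *)
  pose c' i := c i - (if i == freq0 _ _ then (average f)%:C else 0).
  have <- : c' j = c j by rewrite /c' (negbTE j0) subr0.
  apply: trig_coef_le fA => z; rewrite /centered rmorphB /= fE.
  rewrite /c'; under [RHS]eq_bigr do rewrite mulrBl; rewrite sumrB; congr (_ - _).
  rewrite (bigD1 (freq0 _ _))//= eqxx phase_freq0 cexp0 mulr1 big1 ?addr0// => i i0.
  by rewrite (negbTE i0) mul0r.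
have Lgt0 (j : freq (n + d) r.*2) : 0 < kernhat_prod R s j.
  by have [h _] := kernhat_prod_bounds j dl2 dl1; apply: lt_le_trans h; rewrite divr_gt0.
have lower x w : cube n x -> cube d w -> cstar f w - eps <= deconv s c (pt x w).
  move=> cx _; have := deconv_close (pt x w) dl2 dl1 coefA.
  rewrite -fE /= -/dl mulrA -/K -/eps => le1; apply: le_trans le1.
  by rewrite lerD2r; exact: cstar_le.
have [W [Wpsd WE]] := sos_certificate fE Lgt0 lower.
set N := ((s + r).*2).+2 in WE.
pose g w := \sum_(y : {ffun 'I_d -> 'I_N}) kernw s w y * cstar f (gridpt R y) - eps.
have gct : ctrig s.*2 g.
  exact: (ctrigD (@ctrig_kernw_sum R d s N (cstar f)) (@ctrig_cst R d s.*2 (- eps))).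
have gint : nu.-integrable (cube d) (EFin \o g).
  by apply: integrable_cube; [exact: measurable_ctrig gct|exact: ctrig_bounded gct].
pose eta : R := `|L| * d%:R * ((pi ^+ 2 + 1) / s.+1%:R).
have cg w : cstar f w <= g w + (eps + eta).
  have sN : (s.*2.+1 < N)%N by rewrite /N !ltnS leq_double leq_addr.
  have := kernw_approx w (normr_ge0 L) sN cper clip; rewrite -/eta ler_norml => /andP[+ _].
  by rewrite /g; lra.
have gpsos : ((Rintegral nu (cube d) g)%:E <= psos f nu s)%E.
  apply: ereal_sup_ubound; exists g => //; split; first exact/trigpolyP.
  by exists W; split=> // x w _ _; exact: WE.
have cstint : nu.-integrable (cube d) (EFin \o cst (eps + eta)).
  by apply: integrable_cube => //; exists `|eps + eta|.
(* As [nu] gives the cube mass 1, the constant error integrates to itself. *)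
have pg : pstar f nu <= Rintegral nu (cube d) g + (eps + eta).
  have -> : eps + eta = Rintegral nu (cube d) (cst (eps + eta)).
    by rewrite Rintegral_cst// (congr1 fine nu1) mulr1.
  rewrite -RintegralD//; apply: le_Rintegral => //; last by move=> w _; exact: cg.
  exact: (integrableD mcube gint cstint).
apply: (@le_trans _ _ (Rintegral nu (cube d) g + (eps + eta))%:E); first by rewrite lee_fin.
rewrite EFinD; apply: leeD => //.
rewrite lee_fin mulrA ler_pdivlMr//.
have epsle : eps * s%:R <= K * D.
  by rewrite /eps -mulrA ler_wpM2l// -ler_pdivlMr.
have etale : eta * s%:R <= `|L| * d%:R * (pi ^+ 2 + 1).
  have aux (a p q t : R) : a * (p / q) * t = a * p * (t / q) by ring.
  by rewrite /eta aux ler_piMr// ler_pdivrMr ?ltr0n// mul1r ler_nat.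
(* The error is at most [C / s]; the logarithm enters only through [ln s >= 1]. *)
rewrite mulrDl; apply: (@le_trans _ _ C); first by rewrite /C; lra.
by rewrite ler_peMr// ltW.
Qed.
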